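(* Let $A\in R(\Omega)$, with associated sequences $(a_n),(b_n),(c_n),(d_n)$ having limits $a,b,c,d$, be such that the involution kernel of $A$ based at $x'=0^\infty$ exists, and let $A^*$ be the associated dual potential. Then, writing a point $y\in\Omega^-$ as the sequence $y_1y_2y_3\dots$, for all $n\in\mathbb N$ and $z\in\Omega$: - $A^*(0^\infty)=a$; - $A^*(0^{n+1}1z)=a$; - $A^*(01^n0z)=a$; - $A^*(01^\infty)=a$; - $A^*(1^\infty)=c$; - $A^*(1^{n+1}0z)=c_{n+1}+b_{n+1}-b_n$; - $A^*(10^n1z)=(b_1-a)+\sum_{j=2}^n(a_j-a)+d_n$; - $A^*(10^\infty)=d+(b_1-a)+\sum_{j=2}^\infty(a_j-a)$.
   Context: $\mathbb N=\{1,2,\dots\}$, $\Omega=\{0,1\}^{\mathbb N}$ with the product topology. $\Omega^-$ is a copy of $\Omega$ whose points are written $y=(y_1,y_2,\dots)$; $\hat\Omega=\Omega^-\times\Omega$, with points $(y|x)=(\dots,y_2,y_1|x_1,x_2,\dots)$. The Walters family $R(\Omega)$ is the set of continuous $A:\Omega\to\mathbb R$ for which there are convergent real sequences $(a_n),(b_n),(c_n),(d_n)$ such that for all $n\in\mathbb N$, $w\in\Omega$: $A(0^{n+1}1w)=a_{n+1}$, $A(01^n0w)=b_n$, $A(1^{n+1}0w)=c_{n+1}$, $A(10^n1w)=d_n$. The involution kernel of $A$ based at $x'\in\Omega$ is $W(y|x)=\sum_{n\ge1}[A(y_n,\dots,y_1,x_1,x_2,\dots)-A(y_n,\dots,y_1,x'_1,x'_2,\dots)]$;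 it exists if this series converges for every $(y|x)\in\hat\Omega$. The associated dual potential $A^*:\Omega^-\to\mathbb R$ is $$A^*(y)=A(y_1,x_1,x_2,\dots)+W\big((y_2,y_3,\dots)\,|\,(y_1,x_1,x_2,\dots)\big)-W(y|x),$$ whose right-hand side does not depend on $x\in\Omega$. *)

(* Defs.v *)
From HB Require Import structures.
From mathcomp Require Import all_boot all_order all_algebra.
From mathcomp Require Import lra.
From mathcomp Require Import all_classical all_reals all_analysis.
Import Order.TTheory GRing.Theory Num.Theory.
Import numFieldNormedType.Exports.

Set Implicit Arguments.
Unset Strict Implicit.
Unset Printing Implicit Defensive.

Local Open Scope classical_set_scope.
Local Open Scope ring_scope.

(* A point is indexed from 0: x k stands for the coordinate x_{k+1}, with
   [false] for the symbol 0 and [true] for the symbol 1.  The copy Omega^- of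
   Omega is the same type. *)
Notation Omega := cantor_space.

(* The point s_0 s_1 ... s_{m-1} x_1 x_2 ... for a finite word s. *)
Definition prepend (s : seq bool) (x : Omega) : Omega :=
  fun k : nat => nth (x (k - size s)%N) s k.

Definition cst_pt (b : bool) : Omega := fun=> b.

Definition shift (y : Omega) : Omega := fun k : nat => y k.+1.

(* The word y_n ... y_1. *)
Definition past (y : Omega) (n : nat) : seq bool := rev (mkseq y n).

Section Potential.
Context {R : realType}.
Implicit Types (A : Omega -> R) (x y : Omega).

(* The values a_ 0, c_ 0, a_ 1, c_ 1, b_ 0, d_ 0 are irrelevant. *)
Definition walters_sequences A (a_ b_ c_ d_ : nat -> R) : Prop :=
  forall (n : nat) (w : Omega), (0 < n)%N ->
  [/\ A (prepend (nseq n.+1 false ++ [:: true]) w) = a_ n.+1,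
      A (prepend (false :: nseq n true ++ [:: false]) w) = b_ n,
      A (prepend (nseq n.+1 true ++ [:: false]) w) = c_ n.+1 &
      A (prepend (true :: nseq n false ++ [:: true]) w) = d_ n].

(* The summand of index n + 1 in the series defining W(y|x). *)
Definition kernel_term A (x' y x : Omega) (n : nat) : R :=
  A (prepend (past y n.+1) x) - A (prepend (past y n.+1) x').

Definition involution_kernel_exists A (x' : Omega) : Prop :=
  forall y x, cvgn (series (kernel_term A x' y x)).

(* The value W(y|x); meaningful when the kernel exists. *)
Definition involution_kernel A (x' y x : Omega) : R :=
  limn (series (kernel_term A x' y x)).

Definition is_dual_potential A (x' : Omega) (Astar : Omega -> R) : Prop :=
  forall y x,
    Astar y = A (prepend [:: y 0%N] x)
      + involution_kernel A x' (shift y) (prepend [:: y 0%N] x)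
      - involution_kernel A x' y x.

Lemma prepend_past_shift y x n :
  prepend (past (shift y) n) (prepend [:: y 0%N] x) = prepend (past y n.+1) x.
Proof.
have -> : past y n.+1 = past (shift y) n ++ [:: y 0%N].
  by rewrite /past /mkseq /= rev_cons -cats1 (iotaDl 1 0) -map_comp.
apply/funext => k; rewrite /prepend nth_cat size_cat /= addn1.
have [kn|nk] := ltnP k (size (past (shift y) n)); first exact: set_nth_default.
by rewrite [LHS]nth_default// -subnDA addn1.
Qed.

(* The right-hand side defining the dual potential does not depend on x, so
   that the dual potential exists (and is unique) whenever the kernel exists. *)
Lemma dual_potential_exists A x' :
  involution_kernel_exists A x' -> exists! Astar, is_dual_potential A x' Astar.
Proof.
move=> K.
pose F y x := A (prepend [:: y 0%N] x)
  + involution_kernel A x' (shift y) (prepend [:: y 0%N] x)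
  - involution_kernel A x' y x.
have Fx y x : F y x = F y x'.
  have cvF z : (fun n => A (prepend [:: y 0%N] z)
      + series (kernel_term A x' (shift y) (prepend [:: y 0%N] z)) n
      - series (kernel_term A x' y z) n) @ \oo --> F y z.
    by apply: cvgB; [apply: cvgD; [exact: cvg_cst|]|]; exact: K.
  have t0 : kernel_term A x' y x @ \oo --> (0 : R).
    by apply: cvg_series_cvg_0; exact: K.
  have E n : kernel_term A x' y x n =
    (A (prepend [:: y 0%N] x)
      + series (kernel_term A x' (shift y) (prepend [:: y 0%N] x)) n
      - series (kernel_term A x' y x) n) -
    (A (prepend [:: y 0%N] x')
      + series (kernel_term A x' (shift y) (prepend [:: y 0%N] x')) n
      - series (kernel_term A x' y x') n).
    elim: n => [|n]; first by rewrite /series/= !big_geq// !addr0 !subr0.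
    rewrite !seriesEnat /= !(big_nat_recr n)//= /kernel_term.
    by rewrite !prepend_past_shift; lra.
  have tF : kernel_term A x' y x @ \oo --> F y x - F y x'.
    by rewrite (funext E : kernel_term A x' y x = _); exact: cvgB.
  by apply/eqP; rewrite -subr_eq0; apply/eqP; exact: (cvg_unique _ tF t0).
exists (fun y => F y x'); split=> [y x|G HG]; first by rewrite -(Fx y x).
by apply/funext => y; rewrite (HG y x').
Qed.

End Potential.

(* Main.v *)
Require Import Defs.
From mathcomp Require Import all_boot all_order all_algebra.
From mathcomp Require Import all_classical all_reals all_analysis.
Import Order.TTheory GRing.Theory Num.Theory.
Import numFieldNormedType.Exports.
Local Open Scope classical_set_scope.
Local Open Scope ring_scope.

(* Evaluating the definition of A^* at x = 0^oo, where W(y|0^oo) = 0, gives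
     A^*(y) = A(y_1 0^oo)
       + \sum_(n >= 1) [A(y_{n+1} ... y_2 y_1 0^oo) - A(y_{n+1} ... y_2 0^oo)].
   If y_1 = 0 every summand vanishes.  If y_1 = 1, the summands coming from the
   run of equal symbols f after y_1 telescope for f = 1 and are b_1 - a, a_2 - a,
   a_3 - a, ... for f = 0; the summand at the end of the run contributes
   b_{n+1} - b_n or d_n - d; the later ones vanish, since the value of A at a
   point depends only on its coordinates up to the symbol ending its second run. *)
Lemma prepend_cat (s t : seq bool) (x : Omega) :
  prepend (s ++ t) x = prepend s (prepend t x).
Proof.
apply/funext => k; rewrite /prepend nth_cat size_cat subnDA.
by case: ltnP => // ks; [exact: set_nth_default|rewrite [RHS]nth_default].
Qed.

Lemma prepend0 (x : Omega) : prepend [::] x = x.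
Proof. by apply/funext => k; rewrite /prepend nth_nil subn0. Qed.

Lemma prepend_cst_pt (b : bool) : prepend [:: b] (cst_pt b) = cst_pt b.
Proof. by apply/funext => -[|k]; rewrite /prepend //= nth_nil. Qed.

Lemma prepend_nseq_cst_pt (b : bool) (n : nat) :
  prepend (nseq n b) (cst_pt b) = cst_pt b.
Proof.
elim: n => [|n IHn]; first exact: prepend0.
by rewrite -addn1 nseqD prepend_cat prepend_cst_pt.
Qed.

(* The short name shift is taken by translations in mathcomp-analysis. *)
Lemma shift_prepend (e : bool) (s : seq bool) (x : Omega) :
  Defs.shift (prepend (e :: s) x) = prepend s x.
Proof. by apply/funext => k; rewrite /Defs.shift /prepend /= subSS. Qed.

Lemma mkseq_shift (y : Omega) (n : nat) :
  mkseq y n.+1 = y 0%N :: mkseq (Defs.shift y) n.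
Proof. by rewrite /mkseq /= (iotaDl 1 0) -map_comp. Qed.

Lemma past_cst_pt (b : bool) (n : nat) : past (cst_pt b) n = nseq n b.
Proof.
rewrite /past; suff -> : mkseq (cst_pt b) n = nseq n b by exact: rev_nseq.
by elim: n => // n IHn; rewrite mkseq_shift /= -IHn.
Qed.

(** Truncated subtraction covers both cases: for n <= size s the first factor is empty. *)
Lemma past_prepend (s : seq bool) (z : Omega) (n : nat) :
  past (prepend s z) n = past z (n - size s) ++ rev (take n s).
Proof.
rewrite /past -rev_cat; congr rev.
elim: s n => [|e s IHs] n; last case: n => // n.
  by rewrite subn0 prepend0.
by rewrite mkseq_shift shift_prepend IHs.
Qed.

(** * Convergence in the product topology *)

Lemma cvg_cantor (u : nat -> Omega) (x : Omega) :
  (forall k, \forall n \near \oo, u n k = x k) -> u @ \oo --> x.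
Proof.
move=> ux; apply/cvg_sup => k B [C [[D oD <-] Dx] CB].
apply: filterS (ux k) => n unx; apply: CB.
by rewrite /preimage /= /proj /= unx.
Qed.

(** Coordinate k is settled once n > k, so the tails [u n] may vary freely. *)
Lemma cvg_prepend_nseq (s : seq bool) (b : bool) (u : nat -> Omega) :
  (fun n => prepend (s ++ nseq n b) (u n)) @ \oo --> prepend s (cst_pt b).
Proof.
apply: cvg_cantor => k; exists k.+1 => // n /= kn.
rewrite /prepend nth_cat; case: ltnP => ks; first exact: set_nth_default.
rewrite (@nth_default _ _ s)// nth_nseq size_cat size_nseq.
by rewrite ifT// (leq_ltn_trans (leq_subr _ _)).
Qed.

(** * Prefixes that determine the value of [A] *)

Section WaltersPotential.
Set Implicit Arguments.
Unset Strict Implicit.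
Context {R : realType} (A : Omega -> R) (a_ b_ c_ d_ : nat -> R).
Hypothesis A_walters : walters_sequences A a_ b_ c_ d_.

(** With f the first symbol of [s], the prefix of [e :: s] up to the first [~~ f] in [s] is e f^m
    (~~f) with m >= 1; the four choices of e and f are the four families defining a Walters
    potential. *)
Lemma walters_prefix (e : bool) (s : seq bool) (x x' : Omega) :
  (forall b, b \in s) -> A (prepend (e :: s) x) = A (prepend (e :: s) x').
Proof.
case: s => [/(_ true)//|f s] /(_ (~~ f)); rewrite inE; case: eqP => [|_ /=].
  by case: f.
rewrite -has_pred1 => /split_find[_ p t /eqP-> fp].
have -> : p = nseq (size p) f.
  apply/all_pred1P; rewrite -[all _ _]negbK -has_predC; apply: contra fp.
  by apply: sub_has => b /=; case: b; case: (f).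
have -> : e :: f :: rcons (nseq (size p) f) (~~ f) ++ t
    = (e :: nseq (size p).+1 f ++ [:: ~~ f]) ++ t by rewrite -cats1.
rewrite !prepend_cat; move: (prepend t x) (prepend t x') => w w'.
have W := @A_walters (size p).+1 _ isT.
have [a1 b1 c1 d1] := W w; have [a2 b2 c2 d2] := W w'.
by case: e f {fp W} => -[] /=;
  [rewrite c1 c2|rewrite d1 d2|rewrite b1 b2|rewrite a1 a2].
Qed.

End WaltersPotential.

(** * The series for A^* and its truncation on cylinders *)

Section DualPotential.
Set Implicit Arguments.
Unset Strict Implicit.
Context {R : realType} (A : Omega -> R) (x' : Omega) (Astar : Omega -> R).
Hypothesis Astar_dual : is_dual_potential A x' Astar.

(* The definition of A^* evaluated at the base point x', where W(y|x') = 0. *)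
Lemma dual_potential_base (y : Omega) :
  Astar y = A (prepend [:: y 0%N] x')
    + limn (series (kernel_term A x' (Defs.shift y) (prepend [:: y 0%N] x'))).
Proof.
rewrite (@Astar_dual y x') /involution_kernel.
suff -> : series (kernel_term A x' y x') = cst 0 by rewrite lim_cst// subr0.
apply/funext => n; rewrite /series /= big1// => i _.
by rewrite /kernel_term subrr.
Qed.

Context (a_ b_ c_ d_ : nat -> R).
Hypothesis A_walters : walters_sequences A a_ b_ c_ d_.

(* Once the word y_n ... y_2 with n > size s + 1 is placed in front, s is no
   longer at the start, so both values of A in the summand agree by
   walters_prefix and the series is a finite sum. *)
Lemma dual_potential_cylinder (e : bool) (s : seq bool) (z : Omega) :
  (forall b, b \in s) ->
  Astar (prepend (e :: s) z) = A (prepend [:: e] x') + \sum_(0 <= i < size s)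
    (A (prepend (rev (take i.+1 s)) (prepend [:: e] x'))
     - A (prepend (rev (take i.+1 s)) x')).
Proof.
move=> sb; rewrite dual_potential_base shift_prepend; congr (_ + _).
apply: (cvg_lim (@Rhausdorff _)); apply: cvg_near_cst; exists (size s) => // n /= sn.
rewrite /series /= (big_cat_nat (leq0n _) sn) /=.
rewrite [X in _ + X]big_nat_cond [X in _ + X]big1
  ?addr0 => [|i /andP[/andP[si _] _]].
  rewrite big_nat_cond [RHS]big_nat_cond.
  apply: eq_bigr => i /andP[/andP[_ si] _]; rewrite /kernel_term past_prepend.
  by move: (si); rewrite -subn_eq0 => /eqP->.
rewrite /kernel_term past_prepend subSn// take_oversize ?leqW//.
(* Isolates the leading letter of the past of [z]: it takes the role of [e] in [walters_prefix], and
   the rest still contains the reversed [s]. *)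
rewrite /past /mkseq -addn1 iotaD map_cat rev_cat /=.
apply/eqP; rewrite subr_eq0; apply/eqP.
by apply: (walters_prefix A_walters) => b; rewrite mem_cat !mem_rev sb orbT.
Qed.

End DualPotential.

(** * Contribution of the run following y_1 *)

Section Walters.
Set Implicit Arguments.
Unset Strict Implicit.
Context {R : realType} (A : Omega -> R) (a_ b_ c_ d_ : nat -> R).
Hypothesis A_walters : walters_sequences A a_ b_ c_ d_.

Local Notation zeros := (cst_pt false).

(** Summand of the series for A^* at 1 f^oo; a run f^n after y_1 = 1 contributes the first n of
    them. *)
Definition run_term (f : bool) (i : nat) : R :=
  A (prepend (nseq i.+1 f) (prepend [:: true] zeros))
  - A (prepend (nseq i.+1 f) zeros).

Lemma run_term_cst (f : bool) :
  kernel_term A zeros (cst_pt f) (prepend [:: true] zeros) = run_term f.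
Proof. by apply/funext => i; rewrite /kernel_term past_cst_pt. Qed.

(** The symbol y_1 = 1 joins the run of ones, so consecutive summands share a value of [A]. *)
Lemma series_run_term_true (n : nat) :
  series (run_term true) n
  = A (prepend (nseq n.+1 true) zeros) - A (prepend [:: true] zeros).
Proof.
have /= <- := telescope_sumr
  (fun i => A (prepend (nseq i.+1 true) zeros)) (leq0n n).
apply: eq_bigr => i _; rewrite /run_term -prepend_cat.
by rewrite (_ : nseq i.+1 true ++ _ = nseq i.+2 true)// -(addn1 i.+1) nseqD.
Qed.

Lemma walters_ones_zeros (n : nat) : A (prepend (nseq n.+2 true) zeros) = c_ n.+2.
Proof.
rewrite -(prepend_cst_pt false) -prepend_cat.
by have [_ _ -> _] := @A_walters n.+1 zeros isT.
Qed.

Variable a : R.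
Hypothesis A_zeros : A zeros = a.

Lemma series_run_term_false (n : nat) :
  series (run_term false) n.+1
  = (b_ 1%N - a) + \sum_(2 <= j < n.+2) (a_ j - a).
Proof.
(* Summand 0 involves A(010^oo) = b_1; summand i+1 starts with i+2 zeros, giving a_{i+2}. *)
rewrite /series /= big_nat_recl// big_add1 big_add1 /=; congr (_ + _).
  rewrite /run_term prepend_nseq_cst_pt A_zeros -(prepend_cst_pt false) -!prepend_cat.
  by have [_ -> _ _] := @A_walters 1 zeros isT.
apply: eq_bigr => i _; rewrite /run_term prepend_nseq_cst_pt A_zeros -prepend_cat.
by have [-> _ _ _] := @A_walters i.+1 zeros isT.
Qed.

Context (Astar : Omega -> R).
Hypothesis Astar_dual : is_dual_potential A zeros Astar.

(** The word f^n (~~f) contains both symbols because n > 0; its proper prefixes give the run terms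
    and the whole word the last bracket. *)
Lemma dual_potential_run (f : bool) (n : nat) (z : Omega) : (0 < n)%N ->
  Astar (prepend (true :: nseq n f ++ [:: ~~ f]) z)
  = A (prepend [:: true] zeros) + series (run_term f) n
    + (A (prepend (~~ f :: nseq n f) (prepend [:: true] zeros))
       - A (prepend (~~ f :: nseq n f) zeros)).
Proof.
move=> n0; rewrite (dual_potential_cylinder Astar_dual A_walters); last first.
  by move=> b; rewrite mem_cat mem_nseq n0 inE; case: b f => -[].
rewrite size_cat size_nseq addn1 big_nat_recr//= addrA; congr (_ + _ + _).
  rewrite /series /= big_nat_cond [RHS]big_nat_cond.
  apply: eq_bigr => i /andP[/andP[_ ni] _].
  by rewrite takel_cat ?size_nseq// take_nseq// rev_nseq.
by rewrite take_oversize ?size_cat ?size_nseq ?addn1// rev_cat rev_nseq.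
Qed.

(** Prepending 0 to 0^oo gives the base point back, so each kernel term is a difference of equal
    values. *)
Lemma dual_potential_zero (y : Omega) : y 0%N = false -> Astar y = a.
Proof.
move=> y0; rewrite (dual_potential_base Astar_dual) y0 prepend_cst_pt A_zeros.
suff -> : series (kernel_term A zeros (Defs.shift y) zeros) = cst 0.
  by rewrite lim_cst// addr0.
apply/funext => n; rewrite /series /= big1// => i _.
by rewrite /kernel_term subrr.
Qed.

Lemma dual_potential_tail (f : bool) :
  Astar (prepend [:: true] (cst_pt f))
  = A (prepend [:: true] zeros) + limn (series (run_term f)).
Proof.
rewrite (dual_potential_base Astar_dual) shift_prepend.
by rewrite prepend0 run_term_cst.
Qed.

End Walters.

Theorem mainTheorem5 (R : realType) (A : Omega -> R)
    (a_ b_ c_ d_ : nat -> R) (a b c d : R)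
    (A_continuous : continuous A)
    (A_walters : walters_sequences A a_ b_ c_ d_)
    (a_cvg : a_ @ \oo --> a) (b_cvg : b_ @ \oo --> b)
    (c_cvg : c_ @ \oo --> c) (d_cvg : d_ @ \oo --> d)
    (kernel_exists : involution_kernel_exists A (cst_pt false))
    (Astar : Omega -> R)
    (Astar_dual : is_dual_potential A (cst_pt false) Astar) :
  (forall (n : nat) (z : Omega), (0 < n)%N ->
    [/\ Astar (prepend (nseq n.+1 false ++ [:: true]) z) = a,
        Astar (prepend (false :: nseq n true ++ [:: false]) z) = a,
        Astar (prepend (nseq n.+1 true ++ [:: false]) z)
          = c_ n.+1 + b_ n.+1 - b_ n &
        Astar (prepend (true :: nseq n false ++ [:: true]) z)
          = (b_ 1%N - a) + \sum_(2 <= j < n.+1) (a_ j - a) + d_ n]) /\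
  [/\ Astar (cst_pt false) = a,
      Astar (prepend [:: false] (cst_pt true)) = a,
      Astar (cst_pt true) = c,
      cvgn (fun N : nat => \sum_(2 <= j < N) (a_ j - a)) &
      Astar (prepend [:: true] (cst_pt false))
        = d + (b_ 1%N - a) + limn (fun N : nat => \sum_(2 <= j < N) (a_ j - a))].
Proof.
set zeros := cst_pt false in kernel_exists Astar_dual *.
(* By continuity, A(s 0^oo) is the limit of A(s 0^n x); this identifies A(0^oo) with a and A(10^oo)
   with d. *)
have A_lim s x (v : nat -> R) l : v @ \oo --> l ->
    (forall n, A (prepend (s ++ nseq n.+2 false) x) = v n.+2) ->
    A (prepend s zeros) = l.
  move=> vl Av; apply: (cvg_unique _ _ vl) => //.
  rewrite /= -2!cvg_shiftS -(funext Av).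
  have : (fun n => A (prepend (s ++ nseq n false) x)) @ \oo
      --> A (prepend s zeros).
    apply: continuous_cvg; first exact: A_continuous.
    exact: (cvg_prepend_nseq s false (fun=> x)).
  by move=> A_cvg; rewrite -2!cvg_shiftS in A_cvg.
have A_zeros : A zeros = a.
  rewrite -[zeros]prepend0; apply: (A_lim _ (prepend [:: true] zeros) _ _ a_cvg).
  by move=> n; rewrite -prepend_cat; have [-> _ _ _] := A_walters n.+1 zeros isT.
have A_one_zeros : A (prepend [:: true] zeros) = d.
  apply: (A_lim _ (prepend [:: true] zeros) _ _ d_cvg) => n.
  by rewrite -prepend_cat; have [_ _ _ ->] := A_walters n.+2 zeros isT.
(* Existence of the kernel at the point (f^oo | 10^oo); for f = 0 it makes the sum of the a_j - a
   converge. *)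
have run_cvg f : cvgn (series (run_term A f)).
  by rewrite -run_term_cst; exact: kernel_exists.
have a_sumE n : \sum_(2 <= j < n.+2) (a_ j - a)
    = series (run_term A false) n.+1 - (b_ 1%N - a).
  by rewrite (series_run_term_false A_walters A_zeros) addrAC subrr add0r.
have a_sum_cvg : (fun N => \sum_(2 <= j < N) (a_ j - a)) @ \oo -->
    limn (series (run_term A false)) - (b_ 1%N - a).
  rewrite -2!cvg_shiftS (funext a_sumE).
  by apply: cvgB; [rewrite cvg_shiftS; exact: run_cvg|exact: cvg_cst].
have ones_cvg : series (run_term A true) @ \oo
    --> c - A (prepend [:: true] zeros).
  have E n : series (run_term A true) n.+1
      = c_ n.+2 - A (prepend [:: true] zeros).
    by rewrite series_run_term_true (walters_ones_zeros A_walters).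
  rewrite -cvg_shiftS (funext E); apply: cvgB; last exact: cvg_cst.
  by rewrite (cvg_shiftS (fun n => c_ n.+1)) cvg_shiftS.
split=> [[//|n] z n0|]; split.
- exact: (dual_potential_zero A_zeros Astar_dual).
- exact: (dual_potential_zero A_zeros Astar_dual).
(* 1^{n+1} 0 is read as y_1 = 1 followed by 1^n 0; the value A(10^oo) cancels in the telescoped
   sum. *)
- apply: (etrans (dual_potential_run A_walters Astar_dual true z n0)).
  rewrite series_run_term_true (addrC (A _)) subrK (walters_ones_zeros A_walters) -addrA.
  congr (_ + (_ - _)).
    rewrite -prepend_cat (_ : _ ++ _ = false :: nseq n.+2 true); last first.
      by rewrite -(addn1 n.+1) nseqD.
    rewrite -[cst_pt false]prepend_cst_pt -prepend_cat.
    by have [_ -> _ _] := A_walters n.+2 zeros isT.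
  rewrite -[cst_pt false]prepend_cst_pt -prepend_cat.
  by have [_ -> _ _] := A_walters n.+1 zeros isT.
(* The final bracket is d_n - d, and its d cancels the leading A(10^oo). *)
- apply: (etrans (dual_potential_run A_walters Astar_dual false z n0)).
  rewrite (series_run_term_false A_walters A_zeros) -prepend_cat.
  have [_ _ _ ->] := A_walters n.+1 zeros isT.
  rewrite (prepend_cat [:: true] (nseq n.+1 false)) prepend_nseq_cst_pt A_one_zeros.
  by rewrite (addrC d) -addrA (addrC d) subrK.
- exact: (dual_potential_zero A_zeros Astar_dual).
- exact: (dual_potential_zero A_zeros Astar_dual).
- rewrite -prepend_cst_pt (dual_potential_tail Astar_dual).
  by rewrite (cvg_lim (@Rhausdorff _) ones_cvg) addrC subrK.
- by apply/cvg_ex; eexists; exact: a_sum_cvg.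
- rewrite (dual_potential_tail Astar_dual) A_one_zeros.
  by rewrite (cvg_lim (@Rhausdorff _) a_sum_cvg) -addrA (addrC (_ - a)) subrK.
Qed.
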